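(* Let $d\ge 2$ be an even integer and $n$ a positive integer. If there exists a $d\times n$ equiangular tight frame (ETF) in the real symplectic space $\mathbb{R}_{\mathcal S}^d$, then one of the following holds: either $n=d$ and ($d\equiv 0 \bmod 4$ or $d=2$), or $n=d+1$ and $d\equiv 2 \bmod 4$. (In particular, for $d=2$ the allowed values are $n=2$ and $n=3$.)
   Context: For an even integer $d\ge 2$, let $\Omega$ be the $d\times d$ block-diagonal matrix consisting of $d/2$ diagonal blocks $\begin{bmatrix}0&1\\-1&0\end{bmatrix}$, and let $[x,y]=x^\top\Omega y$ on $\mathbb{R}^d$. The space $\mathbb{R}^d$ with this symplectic form is called real symplectic space and denoted $\mathbb{R}_{\mathcal S}^d$. A sequence $\Phi=\{\varphi_i\}_{i=1}^n$ of vectors in $\mathbb{R}_{\mathcal S}^d$ is identified with the real $d\times n$ matrix whose columns are the $\varphi_i$. Put $\Phi^\dagger=\Phi^\top\Omega$. The Gram matrix of $\Phi$ is the $n\times n$ matrix $\Phi^\dagger\Phi$, with entries $(\Phi^\dagger\Phi)_{ij}=[\varphi_i,\varphi_j]$, and the frame operator is the $d\times d$ matrix $\Phi\Phi^\dagger$. The spectrum $\sigma(\cdot)$ consists of complex eigenvalues. $\Phi$ is a frame in $\mathbb{R}_{\mathcal S}^d$ if there are constants $A,B>0$ (frame bounds) with $A\le|\lambda|\le B$ for all $\lambda\in\sigma(\Phi\Phi^\dagger)$. It is $c$-tight ($c>0$) if one may take $A=B=c$, and tight if it is $c$-tight for some $c>0$. $\Phi$ is equiangular if there is $\mu>0$ with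 $|(\Phi^\dagger\Phi)_{ij}|=\mu$ for all $i\ne j$. A $d\times n$ ETF in $\mathbb{R}_{\mathcal S}^d$ is a sequence of $n$ vectors that is both a tight frame and equiangular. *)

(* Defs.v *)
From mathcomp Require Import all_boot all_order all_algebra.
From mathcomp Require Import complex reals.

Set Implicit Arguments.
Unset Strict Implicit.
Unset Printing Implicit Defensive.

Import Order.TTheory GRing.Theory Num.Theory.
Local Open Scope ring_scope.
Local Open Scope complex_scope.

(* Indices are 0-based, so the 2x2 diagonal blocks [0 1; -1 0] occupy the
   positions {2k, 2k+1}. Intended for even d. *)
Definition Omega (R : realType) (d : nat) : 'M[R]_d :=
  \matrix_(i < d, j < d)
    if ~~ odd i && (j == i.+1 :> nat) then 1
    else if ~~ odd j && (i == j.+1 :> nat) then -1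
    else 0.

Definition sympl (R : realType) (d : nat) (x y : 'cV[R]_d) : R :=
  (x^T *m Omega R d *m y) 0 0.

(* A sequence of n vectors of R^d is the matrix Phi having them as columns. *)
Definition dagger (R : realType) (d n : nat) (Phi : 'M[R]_(d, n)) :
  'M[R]_(n, d) := Phi^T *m Omega R d.

Definition gram (R : realType) (d n : nat) (Phi : 'M[R]_(d, n)) : 'M[R]_n :=
  dagger Phi *m Phi.

Lemma gramE (R : realType) (d n : nat) (Phi : 'M[R]_(d, n)) (i j : 'I_n) :
  gram Phi i j = sympl (col i Phi) (col j Phi).
Proof.
rewrite /sympl tr_col -row_mul [LHS]mxE [RHS]mxE.
by apply: eq_bigr => k _; rewrite [row _ _ _ _]mxE [col _ _ _ _]mxE.
Qed.

Definition frame_operator (R : realType) (d n : nat) (Phi : 'M[R]_(d, n)) :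
  'M[R]_d := Phi *m dagger Phi.

Definition spectrum (R : realType) (d : nat) (M : 'M[R]_d) : pred R[i] :=
  eigenvalue (map_mx (real_complex R) M).

(* The norm of R[i] takes its (real) values in R[i], hence the %:C casts. *)
Definition frame_bounds (R : realType) (d n : nat) (Phi : 'M[R]_(d, n))
  (A B : R) : Prop :=
  [/\ 0 < A, 0 < B &
      forall l : R[i], l \in spectrum (frame_operator Phi) ->
        A%:C <= `|l| <= B%:C].

Definition is_frame (R : realType) (d n : nat) (Phi : 'M[R]_(d, n)) : Prop :=
  exists A B : R, frame_bounds Phi A B.

Definition is_tight (R : realType) (d n : nat) (Phi : 'M[R]_(d, n)) : Prop :=
  exists c : R, frame_bounds Phi c c.

Definition is_equiangular (R : realType) (d n : nat) (Phi : 'M[R]_(d, n)) :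
  Prop :=
  exists2 mu : R, 0 < mu & forall i j : 'I_n, i != j -> `|gram Phi i j| = mu.

Definition is_etf (R : realType) (d n : nat) (Phi : 'M[R]_(d, n)) : Prop :=
  [/\ is_frame Phi, is_tight Phi & is_equiangular Phi].

(* Main.v *)
Require Import Defs.
From mathcomp Require Import all_boot all_order all_algebra reals.
From mathcomp Require Import complex sesquilinear spectral.
From mathcomp Require Import ring zify.

(** Let G be the Gram matrix and F the frame operator of an equiangular
    c-tight frame.  G is real and skew-symmetric, so over the complex numbers
    it is unitarily diagonalizable with purely imaginary eigenvalues.  Since
    G = (dagger Phi) Phi and F = Phi (dagger Phi), the nonzero eigenvalues of
    G are eigenvalues of F and so have modulus c; hence G^3 = - c^2 G
    ([gram_cube]).  As F has no eigenvalue 0, the rank of G is d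
    ([rank_gram]).

    Dividing G by the common modulus mu of its off-diagonal entries gives a
    skew-symmetric matrix S of order n with entries 1 or -1 off the diagonal,
    of rank d, with S^3 = - a S for some a.  The rest concerns S only.

    Parity bounds n.  Modulo 2, S is J - I, whose square is I when n is even;
    so S is invertible for even n ([seidel_unit]), and for odd n a principal
    minor of order n - 1 is nonzero.  Hence n - 1 <= d <= n, and as d is even,
    n = d or n = d + 1 according to the parity of n ([skew_rank_geq]).

    If n = d, then S^2 = - a I: S is a skew conference matrix, so the rows of
    S + I are pairwise orthogonal vectors of signs, and three such vectors
    force 4 to divide n, as for the order of a Hadamard matrix;
    d = 2 escapes because there are only two rows
    ([skew_conference_order]).

    If n = d + 1, then M = S^2 + a I is symmetric, annihilated by S, hence of
    rank at most 1, and has constant diagonal.  This forces M = v^T v for a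
    vector v of signs with v S = 0, so that S bordered by v is a skew
    conference matrix of order n + 1 = d + 2, and 4 divides d + 2
    ([skew_conference_core_order]). *)

Section SymplecticETF.

Set Implicit Arguments.
Unset Strict Implicit.
Unset Printing Implicit Defensive.

Import Order.TTheory GRing.Theory Num.Theory.
Local Open Scope ring_scope.
Local Open Scope sesquilinear_scope.

(** * Spectra *)

Lemma eigenvalue_mulC (F : fieldType) (m n : nat) (A : 'M[F]_(m, n))
    (B : 'M[F]_(n, m)) (l : F) :
  l != 0 -> eigenvalue (B *m A) l -> eigenvalue (A *m B) l.
Proof.
move=> l0 /eigenvalueP[v vE v0]; apply/eigenvalueP; exists (v *m B).
  by rewrite mulmxA -(mulmxA v) vE -scalemxAl.
apply: contraNneq v0 => vB0; move: vE; rewrite mulmxA vB0 mul0mx.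
by move/esym/eqP; rewrite scaler_eq0 (negPf l0).
Qed.

Lemma unitmx_eigenvalue0 (F : fieldType) (n : nat) (A : 'M[F]_n) :
  ~~ eigenvalue A 0 -> A \in unitmx.
Proof.
by rewrite /eigenvalue /eigenspace negbK raddf0 subr0 kermx_eq0 row_free_unit.
Qed.

(** The matrix H = 'i A is Hermitian, so it is unitarily diagonalizable with
    real eigenvalues x.  Each - 'i x is an eigenvalue of A, so x is 0 or
    x^2 = c^2; either way x^3 = c^2 x, and the identity passes to H and A. *)
Lemma skewhermitian_cube (C : numClosedFieldType) (n : nat) (A : 'M[C]_n)
    (c : C) :
  A ^t* = - A ->
  (forall l, eigenvalue A l -> l != 0 -> `|l| = c) ->
  A *m A *m A = - c ^+ 2 *: A.
Proof.
move=> skA specA; pose H := 'i *: A.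
have iC : 'i * 'i = -1 :> C by rewrite -expr2 sqrCi.
have AH : A = - 'i *: H by rewrite /H scalerA mulNr iC opprK scale1r.
have hermH : H \is hermsymmx.
  apply/is_hermitianmxP; rewrite expr0 scale1r /H linearZ /= map_mxZ skA /=.
  have -> : Num.conj 'i = - 'i :> C by exact: conjCi.
  by rewrite scaleNr scalerN opprK.
(* Left transparent, H would unify with any scaled matrix. *)
clearbody H; have := orthomx_spectralP (hermitian_normalmx hermH).
set P := spectralmx H; set x := spectral_diag H => HE.
have Pu : P \in unitmx := spectral_unit H.
have x_real j : x 0 j \is Num.real.
  exact: (mxOverP (hermitian_spectral_diag_real hermH)).
have PH : P *m H = diag_mx x *m P by rewrite {1}HE !mulmxA mulmxV // mul1mx.
have x_cube j : x 0 j * x 0 j * x 0 j = c ^+ 2 * x 0 j.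
  have [->|xj0] := eqVneq (x 0 j) 0; first by rewrite !mulr0.
  congr (_ * _); rewrite -expr2 -real_normK //; congr (_ ^+ 2).
  have <- : `|- 'i * x 0 j| = `|x 0 j| by rewrite normrM normrN normCi mul1r.
  apply: specA; last by rewrite mulNr oppr_eq0 mulf_neq0 ?neq0Ci.
  apply/eigenvalueP; exists (row j P).
    rewrite AH -scalemxAr -row_mul PH -scalerA; congr (_ *: _).
    by rewrite row_mul row_diag_mx -scalemxAl -rowE.
  apply/negP => /eqP rP0; have /row_freeP[Q PQ]: row_free P.
    by rewrite row_free_unit.
  have := congr1 (fun M => row j M 0 j) PQ; rewrite row_mul rP0 mul0mx !mxE.
  by rewrite eqxx => /eqP; rewrite eq_sym oner_eq0.
have H_cube : H *m H *m H = c ^+ 2 *: H.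
  rewrite -[LHS](mulKmx Pu) -[RHS](mulKmx Pu); congr (_ *m _).
  rewrite -scalemxAr !mulmxA PH.
  rewrite -[diag_mx x *m P *m H]mulmxA PH mulmxA.
  rewrite -[_ *m P *m H]mulmxA PH mulmxA scalemxAl.
  congr (_ *m P); apply/matrixP => i j; rewrite mul_diag_mx mul_mx_diag !mxE.
  have [->|_] := eqVneq i j; last by rewrite ?mulr0n ?mulr0 ?mul0r.
  by rewrite mulr1n x_cube.
rewrite AH -!scalemxAl -!scalemxAr -!scalemxAl !scalerA H_cube scalerA.
congr (_ *: _); by rewrite !mulrN !mulNr iC; ring.
Qed.

(** * Ranks and sign vectors *)

Lemma rank_le1_minor (F : fieldType) (m n : nat) (M : 'M[F]_(m, n)) i k j l :
  (\rank M <= 1)%N -> M i j * M k l = M i l * M k j.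
Proof.
move=> rkM; rewrite -(mulmx_base M); move: rkM.
move: (col_base M) (row_base M); case: (\rank M) => [|[|//]] U V _.
  by rewrite !mxE !big_ord0 !mul0r.
by rewrite !mxE !big_ord1; ring.
Qed.

Lemma mxrank_mxsub (F : fieldType) (m n p q : nat) (f : 'I_p -> 'I_m)
    (g : 'I_q -> 'I_n) (A : 'M[F]_(m, n)) :
  (\rank (mxsub f g A) <= \rank A)%N.
Proof.
rewrite -{1}[A]mulmx1 mxsub_mul -{1}[A]mul1mx -mul_rowsub_mx.
exact: leq_trans (mxrankM_maxl _ _) (mxrankM_maxr _ _).
Qed.

(** The sum is that of 1 + x y + x z + y z over the coordinates.  For signs,
    this term is 4 when x = y = z and 0 otherwise. *)
Lemma four_dvd_dots (K : numFieldType) (I : finType) (x y z : I -> K) :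
  (forall k, x k ^+ 2 = 1) -> (forall k, y k ^+ 2 = 1) ->
  (forall k, z k ^+ 2 = 1) ->
  exists m : nat, #|I|%:R + \sum_k x k * y k + \sum_k x k * z k
     + \sum_k y k * z k = (4 * m)%:R.
Proof.
move=> x1 y1 z1.
exists (\sum_k ((x k * y k == 1)%R && (x k * z k == 1)%R))%N.
rewrite natrM natr_sum mulr_sumr -sum1_card natr_sum -!big_split /=.
apply: eq_bigr => k _.
have sgn u : u ^+ 2 = 1 -> u = 1 \/ u = -1 :> K.
  by move/eqP; rewrite sqrf_eq1 => /orP[]/eqP; [left | right].
have ne : (-1 == 1 :> K) = false by rewrite eqNr oner_eq0.
case: (sgn _ (x1 k)) (sgn _ (y1 k)) (sgn _ (z1 k)) => -> [] -> [] ->;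
  rewrite ?(mulr1, mul1r, mulrN, opprK, eqxx, ne) /=; ring.
Qed.

Lemma sum_mul_delta (K : pzSemiRingType) (I : finType) (F : I -> K) (i : I) :
  \sum_k F k * (i == k)%:R = F i.
Proof.
rewrite (bigD1 i) //= eqxx mulr1 big1 ?addr0 // => k /negPf.
by rewrite eq_sym => ->; rewrite mulr0.
Qed.

(** All entries are integers and the determinant is odd: modulo 2 the matrix
    is U = J - I, and U^2 = J^2 - 2 J + I = I because J^2 = n J = 0. *)
Lemma seidel_unit (K : numFieldType) (n : nat) (S : 'M[K]_n) :
  ~~ odd n -> (forall i, S i i = 0) ->
  (forall i j, i != j -> S i j ^+ 2 = 1) -> S \in unitmx.
Proof.
move=> n_even S0 S1.
pose T : 'M[int]_n :=
  \matrix_(i, j) if i == j then 0 else if S i j == 1 then 1 else -1.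
have ST : S = map_mx intr T.
  apply/matrixP => i j; rewrite !mxE.
  case: (eqVneq i j) => [->|/S1 /eqP]; first by rewrite S0.
  by rewrite sqrf_eq1; case: eqP => [->|_ /= /eqP ->]; rewrite ?rmorphN.
pose U : 'M['F_2]_n := map_mx intr T.
have two0 : 1 + 1 = 0 :> 'F_2 by apply/val_inj.
have neg1 : -1 = 1 :> 'F_2 by apply/val_inj.
have UE i j : U i j = 1 - (i == j)%:R.
  rewrite !mxE; case: eqP => _; first by rewrite subrr.
  by rewrite subr0; case: ifP; rewrite ?rmorphN ?rmorph1 ?neg1.
have UU : U *m U = 1%:M.
  apply/matrixP => i j; rewrite [LHS]mxE.
  under eq_bigr => k _ do rewrite !UE mulrBl mul1r mulrBr mulr1 opprB.
  rewrite !big_split /= !sumrN sumr_const card_ord.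
  have -> : 1 *+ n = 0 :> 'F_2.
    rewrite -(odd_double_half n) (negPf n_even) -mul2n.
    by rewrite mulrnA (mulr2n 1) two0 mul0rn.
  have delta_sum l : \sum_k (l == k)%:R = 1 :> 'F_2.
    rewrite -[RHS](sum_mul_delta (fun=> 1) l).
    by apply: eq_bigr => k _; rewrite mul1r.
  under [X in _ - X + _]eq_bigr => k _ do rewrite eq_sym.
  under [X in _ + (X - _)]eq_bigr => k _ do rewrite [k == j]eq_sym.
  rewrite sum_mul_delta !delta_sum.
  by rewrite mxE; case: (i == j); apply/val_inj.
have : \det U != 0.
  apply/eqP => U0; have := congr1 determinant UU.
  by rewrite det_mulmx U0 mul0r det1 => /eqP; rewrite eq_sym oner_eq0.
rewrite unitmxE unitfE ST !det_map_mx intr_eq0.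
by apply: contraNneq => ->.
Qed.

(** * Skew-symmetric matrices with off-diagonal entries 1 or -1 *)

Section SkewSeidel.

Variables (K : numFieldType) (n : nat) (S : 'M[K]_n).
Hypothesis skewS : S^T = - S.
Hypothesis S1 : forall i j, i != j -> S i j ^+ 2 = 1.

Lemma skewE i j : S j i = - S i j.
Proof. by have := congr1 (fun M : 'M_n => M i j) skewS; rewrite !mxE. Qed.

Lemma skew_diag i : S i i = 0.
Proof. by apply/eqP; rewrite -eqNr -skewE. Qed.

Lemma sqr_diag i : (S *m S) i i = - (n%:R - 1).
Proof.
rewrite mxE (bigD1 i) //= skew_diag mul0r add0r.
rewrite (eq_bigr (fun=> - 1)); last first.
  by move=> k ki; rewrite (skewE i k) mulrN -expr2 S1 // eq_sym.
rewrite sumrN sumr_const cardC1 card_ord; congr (- _).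
by rewrite -subn1 natrB // (leq_ltn_trans _ (ltn_ord i)).
Qed.

Lemma skew_sqr_sym i j : (S *m S) j i = (S *m S) i j.
Proof.
rewrite !mxE; apply: eq_bigr => k _.
by rewrite (skewE k j) (skewE i k) mulrNN mulrC.
Qed.

(** Adding I to S replaces its zero diagonal by ones, so that every entry is a
    sign; for a conference matrix S the result is a skew Hadamard matrix. *)
Definition hrow (i k : 'I_n) : K := S i k + (i == k)%:R.

Lemma hrow_sqr i k : hrow i k ^+ 2 = 1.
Proof.
rewrite /hrow; case: (eqVneq i k) => [->|ik]; last by rewrite addr0 S1.
by rewrite skew_diag add0r expr1n.
Qed.

(** (S + I) (S + I)^T = S S^T + I + (S + S^T) = I - S^2. *)
Lemma hrow_dot i j : i != j ->
  \sum_k hrow i k * hrow j k = - (S *m S) i j.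
Proof.
move=> ij; rewrite /hrow.
under eq_bigr => k _ do rewrite mulrDr 2!mulrDl.
rewrite !big_split /= !sum_mul_delta (negPf ij) addr0.
under [X in _ + X + _]eq_bigr => k _ do rewrite mulrC.
rewrite sum_mul_delta -addrA (skewE i j) addNr addr0 mxE -sumrN.
by apply: eq_bigr => k _; rewrite (skewE j k) mulrN opprK.
Qed.

(** Three distinct rows of S + I are pairwise orthogonal, so
    [four_dvd_dots] applied to them says that n itself is a multiple of 4. *)
Lemma skew_conference_order (a : K) :
  (2 < n)%N -> S *m S = a%:M -> (4 %| n)%N.
Proof.
move=> n_gt2 SS.
pose o k (hk : (k < 3)%N) : 'I_n := Ordinal (leq_trans hk n_gt2).
pose i0 := o 0%N isT; pose i1 := o 1%N isT; pose i2 := o 2%N isT.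
have dot0 i j : i != j -> \sum_k hrow i k * hrow j k = 0.
  by move=> ij; rewrite hrow_dot // SS mxE (negPf ij) oppr0.
have [m] := four_dvd_dots (hrow_sqr i0) (hrow_sqr i1) (hrow_sqr i2).
rewrite !dot0 // card_ord !addr0 => /eqP; rewrite eqr_nat => /eqP ->.
exact: dvdn_mulr.
Qed.

(** Let M = S^2 + a I.  From M S = 0, M has rank at most 1, and its diagonal
    entries all equal t = a - (n - 1).  The vanishing of the 2 x 2 minors and
    symmetry give M_ij^2 = t^2; comparing the diagonals of M^2 = a M gives
    n t = a, whence t = 1.  So M = v^T v with v a row of M, a vector of signs
    orthogonal to the columns of S.

    Bordering S by v would give a skew conference matrix of order n + 1.
    Instead of building it, apply [four_dvd_dots] to v and to two rows h_i of
    S + I, rescaled by v_i: the dot products are 1, 1 and -1, and they add 1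
    to n. *)
Lemma skew_conference_core_order (a : K) :
  (2 < n)%N -> \rank S = n.-1 -> S *m S *m S = - a *: S -> (4 %| n.+1)%N.
Proof.
move=> n_gt2 rkS SSS.
pose M := S *m S + a%:M.
have MS : M *m S = 0 by rewrite mulmxDl SSS mul_scalar_mx scaleNr addNr.
have Msym i j : M j i = M i j.
  by rewrite mxE [RHS]mxE skew_sqr_sym [a%:M j i]mxE [a%:M i j]mxE eq_sym.
have rkM : (\rank M <= 1)%N.
  have := mxrankS (introT sub_kermxP MS); rewrite mxrank_ker rkS; lia.
have minor i k j l := rank_le1_minor i k j l rkM.
pose t := a - (n%:R - 1).
have Mii i : M i i = t.
  by rewrite mxE sqr_diag [a%:M i i]mxE eqxx mulr1n addrC.
have Msqr i j : M i j ^+ 2 = t ^+ 2.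
  by rewrite expr2 -[X in _ * X]Msym minor !Mii.
pose i0 : 'I_n := Ordinal (ltn_trans (isT : (0 < 2)%N) n_gt2).
pose i1 : 'I_n := Ordinal (ltn_trans (isT : (1 < 2)%N) n_gt2).
have MM : M *m M = a *: M.
  by rewrite {2}/M mulmxDr mulmxA MS mul0mx add0r mul_mx_scalar.
have tE : n%:R * t ^+ 2 = a * t.
  have := congr1 (fun M : 'M_n => M i0 i0) MM; rewrite [LHS]mxE [RHS]mxE Mii.
  move=> <-; rewrite (eq_bigr (fun=> t ^+ 2)).
    by rewrite sumr_const card_ord mulr_natl.
  by move=> k _; rewrite [M k i0]Msym -expr2 Msqr.
have n1 : n%:R - 1 != 0 :> K.
  by rewrite subr_eq0 -[1]/(1%:R) eqr_nat; lia.
(* If t = 0 then M = 0, so S^2 = - (n - 1) I and S would be invertible. *)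
have t0 : t != 0.
  apply/eqP => t0.
  have aE : a = n%:R - 1 by apply/eqP; rewrite -subr_eq0 -/t t0.
  have M0 : M = 0.
    apply/matrixP => i j; apply/eqP; rewrite [X in _ == X]mxE.
    by rewrite -sqrf_eq0 Msqr t0 expr0n.
  have Su : S \in unitmx.
    apply: (proj1 (@mulmx1_unit _ _ S (- a^-1 *: S) _)).
    have SS : S *m S = - a%:M by apply/eqP; rewrite -addr_eq0 -/M M0.
    rewrite -scalemxAr SS scalerN scaleNr opprK scale_scalar_mx.
    by rewrite mulVf // aE.
  by move: rkS; rewrite mxrank_unit //; lia.
have t1 : t = 1.
  have : n%:R * t = a by apply: (mulIf t0); rewrite -tE; ring.
  move=> nt; apply: (mulfI n1); rewrite mulrBl nt mul1r /t; ring.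
pose v k := M i0 k.
have v1 k : v k ^+ 2 = 1 by rewrite Msqr t1 expr1n.
have Mv i j : M i j = v i * v j.
  by rewrite -[LHS]mulr1 -t1 -(Mii i0) minor [M i i0]Msym.
have vS j : \sum_k v k * S k j = 0.
  by have := congr1 (fun M : 'M_n => M i0 j) MS; rewrite mxE [RHS]mxE.
have vh i : \sum_k v k * (v i * hrow i k) = 1.
  transitivity (v i * (\sum_k v k * hrow i k)).
    by rewrite mulr_sumr; apply: eq_bigr => k _; ring.
  under eq_bigr => k _ do rewrite /hrow mulrDr (skewE k i) mulrN.
  rewrite big_split /= sumrN vS oppr0 add0r.
  by rewrite sum_mul_delta -expr2.
have sgn i k : (v i * hrow i k) ^+ 2 = 1 by rewrite exprMn v1 hrow_sqr mul1r.
have [m] := four_dvd_dots v1 (sgn i0) (sgn i1).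
have -> : \sum_k v i0 * hrow i0 k * (v i1 * hrow i1 k) = -1.
  transitivity (v i0 * v i1 * (\sum_k hrow i0 k * hrow i1 k)).
    by rewrite mulr_sumr; apply: eq_bigr => k _; ring.
  rewrite hrow_dot // mulrN; congr (- _).
  have <- : M i0 i1 = (S *m S) i0 i1 by rewrite mxE [a%:M _ _]mxE addr0.
  by rewrite Mv -expr2 exprMn !v1 mul1r.
rewrite !vh card_ord => nE.
have : n.+1%:R = (4 * m)%:R :> K by rewrite -nE -natr1; ring.
by move/eqP; rewrite eqr_nat => /eqP ->; exact: dvdn_mulr.
Qed.

(** For odd n, delete the first row and the first column to reach an even
    order, where [seidel_unit] applies. *)
Lemma skew_rank_geq : (n.-1 <= \rank S)%N.
Proof.
case: (boolP (odd n)) => n_odd; last first.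
  by rewrite mxrank_unit ?leq_pred //; apply: seidel_unit (skew_diag) S1.
have n_gt0 : (0 < n)%N by case: (n) n_odd.
pose i0 : 'I_n := Ordinal n_gt0.
pose f : 'I_n.-1 -> 'I_n := lift i0.
apply: leq_trans (mxrank_mxsub f f S); rewrite mxrank_unit //.
apply: seidel_unit.
- by move: n_odd; rewrite -{1}(prednK n_gt0).
- by move=> i; rewrite mxE skew_diag.
by move=> i j ij; rewrite mxE S1 // (inj_eq lift_inj).
Qed.

Lemma skew_seidel_order (d : nat) (a : K) :
  (2 <= d)%N -> ~~ odd d -> \rank S = d -> S *m S *m S = - a *: S ->
  (n = d /\ ((4 %| d)%N \/ d = 2%N)) \/ (n = d.+1 /\ (4 %| d.+2)%N).
Proof.
move=> d_ge2 d_even rkS SSS.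
have := skew_rank_geq; have := rank_leq_row S; rewrite rkS => dn nd.
have [n_odd|n_even] := boolP (odd n).
  have nE : n = d.+1.
    have : n != d by apply: contraNneq d_even => <-.
    lia.
  right; split=> //; rewrite -nE.
  apply: (skew_conference_core_order (a := a)) => //.
    by rewrite nE.
  by rewrite rkS nE.
have Su : S \in unitmx by apply: seidel_unit (skew_diag) S1.
have nE : n = d by rewrite -rkS mxrank_unit.
left; split=> //; have [->|d2] := eqVneq d 2%N; first by right.
left; rewrite -nE; apply: (skew_conference_order (a := - a)).
  by rewrite nE; lia.
by rewrite -[LHS](mulmxK Su) SSS -mul_scalar_mx mulmxK.
Qed.

End SkewSeidel.

(** * Gram matrices of symplectic equiangular tight frames *)

Lemma skew_complexify (R : rcfType) (n : nat) (G : 'M[R]_n) :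
  G^T = - G ->
  (map_mx (real_complex R) G) ^t* = - map_mx (real_complex R) G.
Proof.
move=> skG; apply/matrixP => i j; rewrite !mxE (skewE skG i j) rmorphN.
by rewrite rmorphN; congr (- _); exact: conjc_real.
Qed.

Section Gram.

Variables (R : realType) (d n : nat) (Phi : 'M[R]_(d, n)).

Lemma tr_Omega : (Omega R d)^T = - Omega R d.
Proof.
apply/matrixP => i j; rewrite !mxE.
case: (boolP (~~ odd i && (j == i.+1 :> nat))) => [/andP[oi /eqP ji]|_].
  have -> : ~~ odd j && (i == j.+1 :> nat) = false by lia.
  by [].
by case: ifP; rewrite ?opprK ?oppr0.
Qed.

Lemma tr_gram : (gram Phi)^T = - gram Phi.
Proof.
rewrite /gram /dagger !trmx_mul tr_Omega trmxK mulNmx mulmxN.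
by rewrite mulmxA.
Qed.

Variable c : R.
Hypothesis c_gt0 : 0 < c.
Hypothesis spec_c : forall l : R[i], l \in spectrum (frame_operator Phi) ->
  `|l| = (c%:C)%C.

Let toC := real_complex R.

Lemma frame_operator_unit : frame_operator Phi \in unitmx.
Proof.
apply: unitmx_eigenvalue0; rewrite -(eigenvalue_map toC) rmorph0.
apply/negP => /spec_c; rewrite normr0 => /eqP.
by rewrite eq_sym fmorph_eq0 gt_eqF.
Qed.

(** G factors through dimension d, and conversely F^2 = Phi G (dagger Phi) has
    rank d because F is invertible. *)
Lemma rank_gram : \rank (gram Phi) = d.
Proof.
apply/eqP; rewrite eqn_leq (leq_trans (mxrankM_maxr _ _) (rank_leq_row _)) /=.
have Fu := frame_operator_unit.
have rkFF : \rank (frame_operator Phi *m frame_operator Phi) = d.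
  by rewrite mxrank_unit // unitmx_mul Fu.
rewrite -[X in (X <= _)%N]rkFF.
have -> : frame_operator Phi *m frame_operator Phi
        = Phi *m gram Phi *m dagger Phi.
  by rewrite /frame_operator /gram !mulmxA.
exact: leq_trans (mxrankM_maxl _ _) (mxrankM_maxr _ _).
Qed.

Lemma gram_cube :
  gram Phi *m gram Phi *m gram Phi = - c ^+ 2 *: gram Phi.
Proof.
apply: (map_mx_inj (f := toC)); rewrite map_mxZ 2!map_mxM rmorphN rmorphXn /=.
apply: skewhermitian_cube.
  exact: skew_complexify tr_gram.
move=> l El l0; apply: spec_c.
rewrite /gram map_mxM in El; have := eigenvalue_mulC l0 El.
by rewrite -map_mxM.
Qed.

End Gram.

(** Normalizing the Gram matrix by mu turns [gram_cube] into the hypothesis of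
    [skew_seidel_order] with a = (c / mu)^2. *)
Lemma etf_order (R : realType) (d n : nat) (Phi : 'M[R]_(d, n)) :
  (2 <= d)%N -> ~~ odd d -> is_etf Phi ->
  (n = d /\ ((4 %| d)%N \/ d = 2%N)) \/ (n = d.+1 /\ (4 %| d.+2)%N).
Proof.
move=> d_ge2 d_even [_ [c [c_gt0 _ spec]] [mu mu_gt0 ang]].
have spec_c l : l \in spectrum (frame_operator Phi) -> `|l| = (c%:C)%C.
  by move=> /spec /andP[h1 h2]; apply/le_anti/andP.
have mu0 : mu != 0 by rewrite gt_eqF.
pose S := mu^-1 *: gram Phi.
apply: (@skew_seidel_order _ _ S _ _ _ (c ^+ 2 / mu ^+ 2)) => //.
- by rewrite linearZ /= tr_gram scalerN.
- move=> i j ij; rewrite mxE -real_normK ?num_real // normrM ang //.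
  by rewrite gtr0_norm ?invr_gt0 // mulVf // expr1n.
- by rewrite mxrank_scale_nz ?invr_eq0 // (rank_gram c_gt0 spec_c).
rewrite /S -!scalemxAl -!scalemxAr -!scalemxAl !scalerA (gram_cube spec_c).
rewrite !scalerA; congr (_ *: _); field.
by [].
Qed.

End SymplecticETF.

Theorem theorem1 (R : realType) (d n : nat)
    (d_ge2 : (2 <= d)%N) (d_even : ~~ odd d) (n_gt0 : (0 < n)%N)
    (etf : exists Phi : 'M[R]_(d, n), is_etf Phi) :
  ((n = d /\ (d = 0 %[mod 4] \/ d = 2)) \/
   (n = d.+1 /\ d = 2 %[mod 4])) /\
  (d = 2 -> n = 2 \/ n = 3).
Proof.
have [Phi etfPhi] := etf.
have := etf_order d_ge2 d_even etfPhi.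
lia.
Qed.
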